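(* Every real Markov tree $T$ with all labels $\ge2$ takes one of these distinct forms: it is either rising, progressing, leveling or constant. In particular, Markov trees with labels $>2$ and discriminator $D\ne4$ are rising.
   Context: A real Markov tree $T$ with base triple $(s_0,u_0,t_0)\in\mathbb R^3$ is a rooted planar trivalent tree (the root has degree 1, all other vertices degree 3) whose complementary regions carry real labels; the root edge has the region $s_0$ on its left, $t_0$ on its right, and leads to the region $u_0$; and for every non-root edge, with regions $s,t$ on its two sides and regions $r,u$ at its two ends, $r+u=st$. The discriminator is $D=s_0^2+u_0^2+t_0^2-s_0u_0t_0$; the labels $r,s,t$ at every non-root vertex satisfy $r^2+s^2+t^2-rst=D$. Edge directions: a non-root edge directed from end region $r$ to end region $u$ has label $u-r$; the root edge directed away from the root has label $2u_0-s_0t_0$. The positive direction of an edge is the one making its label positive; edges with label $0$ are undirected. $T$ is rising if all labels are $>2$ and all edges are positively directed away from the root except for those on a finite (possibly empty) simple path starting at the root. $T$ is progressing if $2\le s_0<u_0$, $2\le t_0<u_0$ and $(s_0-2)(t_0-2)=0$. $T$ is leveling if $D=4$ and either $2<s_0$, $2<t_0$, $2\le u_0<s_0t_0/2$, or else the base triple has the form $(2,t_0,t_0)$ or $(s_0,s_0,2)$ for some $s_0,t_0>2$. $T$ is constant if all its regions have equal labels. *)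

(* Defs.v *)
From HB Require Import structures.
From mathcomp Require Import all_boot all_order all_algebra.
From mathcomp Require Import reals.

Set Implicit Arguments.
Unset Strict Implicit.
Unset Printing Implicit Defensive.

Import Order.TTheory GRing.Theory Num.Theory.
Local Open Scope ring_scope.

(* An edge is the list of turns (false = left, true = right) made on the way
   to it from the root, most recent turn first: [::] is the root edge and
   b :: e is a child of e. *)
Definition edge := seq bool.

(* Every complementary region other than the two beside the root edge is
   ahead of (at the far end of) exactly one edge, all edges being viewed from
   the root. *)
Inductive region := RootLeft | RootRight | Ahead of edge.

Fixpoint left_of (e : edge) : region :=
  match e with
  | [::] => RootLeft
  | false :: e' => left_of e'
  | true :: e' => Ahead e'
  end.

Fixpoint right_of (e : edge) : region :=
  match e with
  | [::] => RootRight
  | false :: e' => Ahead e'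
  | true :: e' => right_of e'
  end.

(* Region at the near end of the non-root edge b :: e: of the three regions
   at the far vertex of e, the one not beside b :: e. *)
Definition behind (b : bool) (e : edge) : region :=
  if b then left_of e else right_of e.

Record markov_tree (R : realType) := MarkovTree {
  label :> region -> R;
  markov_rule : forall (b : bool) (e : edge),
    label (behind b e) + label (Ahead (b :: e)) =
    label (left_of (b :: e)) * label (right_of (b :: e))
}.

Section MarkovTree.
Variables (R : realType) (T : markov_tree R).

Definition s0 : R := T RootLeft.
Definition u0 : R := T (Ahead [::]).
Definition t0 : R := T RootRight.

Definition discriminator : R :=
  s0 ^+ 2 + u0 ^+ 2 + t0 ^+ 2 - s0 * u0 * t0.

(* Label of the edge when directed away from the root; the opposite
   direction carries the opposite label. *)
Definition edge_label (e : edge) : R :=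
  match e with
  | [::] => 2 * u0 - s0 * t0
  | b :: e' => T (Ahead (b :: e')) - T (behind b e')
  end.

Definition directed_away (e : edge) : bool := 0 < edge_label e.

Definition child : rel edge :=
  fun e f => (f == false :: e) || (f == true :: e).

(* Edges of a finite simple path starting at the root: it cannot turn back. *)
Definition root_path (p : seq edge) : bool :=
  match p with
  | [::] => true
  | e :: p' => (e == [::]) && path child e p'
  end.

Definition rising : Prop :=
  (forall x : region, 2 < T x) /\
  exists p : seq edge,
    root_path p /\ forall e : edge, directed_away e <-> e \notin p.

Definition progressing : Prop :=
  [/\ 2 <= s0 < u0, 2 <= t0 < u0 & (s0 - 2) * (t0 - 2) = 0].

Definition leveling : Prop :=
  discriminator = 4 /\
  [\/ [/\ 2 < s0, 2 < t0 & 2 <= u0 < s0 * t0 / 2],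
      [/\ s0 = 2, u0 = t0 & 2 < t0]
    | [/\ t0 = 2, u0 = s0 & 2 < s0]].

Definition constant_tree : Prop := forall x y : region, T x = T y.

End MarkovTree.

(* Main.v *)
(** Around an edge with regions [l], [r] beside it and [u] ahead, the label is
    [2u - lr] and [(2u - lr)^2 = (l^2-4)(r^2-4) + 4(D-4)].  An edge directed away
    from the root has children directed away, and when all labels exceed 2 two
    siblings are never both directed back; so the edges not directed away form
    a path from the root.  If [D <> 4], each step along this path lowers [l + r]
    by at least a fixed positive amount, so the path is finite.  If [D = 4], the
    identity [(2u-lr)(2r-lu)(2l-ur) = (l^2-4)(u^2-4)(r^2-4)] shows that
    the path never ends once it has started.  Finally, the regions around a
    region labelled 2 carry labels in arithmetic progression, which must be
    nondecreasing in both directions as seen from the root. *)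
Require Import Defs.
From HB Require Import structures.
From mathcomp Require Import all_boot all_order all_algebra.
From mathcomp Require Import reals.
From mathcomp Require Import ring lra.

Set Implicit Arguments.
Unset Strict Implicit.
Unset Printing Implicit Defensive.

Import Order.TTheory GRing.Theory Num.Theory.
Local Open Scope ring_scope.

(** * Uniform decrease along back edges *)

Section Descent.
Variable R : realType.
Implicit Types D M l u r : R.

Definition disc l u r : R := l ^+ 2 + u ^+ 2 + r ^+ 2 - l * u * r.

(* If [D > 4] the labels of back edges are bounded away from [0]; if [D < 4] it
   is [l - 2] and [r - 2] that are bounded away from [0]. *)
Lemma descent_step D M : D <> 4 -> exists2 c : R, 0 < c &
  forall l u r, 2 < l -> 2 < u -> 2 < r -> l + r <= M -> disc l u r = D ->
    2 * u <= l * r -> l * u <= 2 * r -> u + c <= r.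
Proof.
move=> /eqP; rewrite neq_lt => /orP[D4|D4]; last first.
  exists (Num.sqrt (D - 4)); first by rewrite sqrtr_gt0; lra.
  move=> l u r l2 u2 r2 _ lurD _ lur.
  have sq : (2 * r - l * u) ^+ 2 = (l ^+ 2 - 4) * (u ^+ 2 - 4) + 4 * (D - 4).
    by rewrite -lurD /disc; ring.
  have pos : 0 <= (l ^+ 2 - 4) * (u ^+ 2 - 4) by apply: mulr_ge0; nra.
  have : Num.sqrt (D - 4) <= (2 * r - l * u) / 2.
    rewrite -[leRHS]ger0_norm; last by lra.
    by rewrite -sqrtr_sqr ler_wsqrtr // exprMn sq; lra.
  nra.
(* [K] bounds [(l + 2) * (r ^+ 2 - 4)] whenever [l + r <= M]; the [+ 1] keeps it positive for the
   division. *)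
pose K := (`|M| + 2) * `|M| ^+ 2 + 1.
have M0 : 0 <= `|M| by [].
have K0 : 0 < K by rewrite /K; nra.
exists (4 * (4 - D) / K); first by apply: divr_gt0 => //; lra.
move=> l u r l2 u2 r2 lrM lurD ulr lur.
have sq : (2 * u - l * r) ^+ 2 = (l ^+ 2 - 4) * (r ^+ 2 - 4) + 4 * (D - 4).
  by rewrite -lurD /disc; ring.
have sq0 : 4 * (4 - D) <= (l - 2) * ((l + 2) * (r ^+ 2 - 4)).
  have := sqr_ge0 (2 * u - l * r); rewrite sq; lra.
have lrM' : l + r <= `|M| by apply: le_trans lrM (ler_norm M).
have bnd : (l + 2) * (r ^+ 2 - 4) <= K.
  apply: le_trans (_ : (`|M| + 2) * `|M| ^+ 2 <= _); last by rewrite /K; lra.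
  by apply: ler_pM; [lra | nra | lra | nra].
have : 4 * (4 - D) / K <= l - 2.
  rewrite ler_pdivrMr //; apply: le_trans sq0 _.
  by apply: ler_wpM2l => //; lra.
(* [r >= l * u / 2 = u + (l - 2) * u / 2 >= u + (l - 2)]. *)
nra.
Qed.

End Descent.

(** * Edge labels and the invariance of the discriminator *)

Section Tree.
Variables (R : realType) (T : markov_tree R).
Implicit Types e f : edge.

Let l e := T (left_of e).
Let u e := T (Ahead e).
Let r e := T (right_of e).

Lemma ahead_left e : u (false :: e) = l e * u e - r e.
Proof. by have /= := markov_rule T false e; rewrite /l /u /r; lra. Qed.

Lemma ahead_right e : u (true :: e) = u e * r e - l e.
Proof. by have /= := markov_rule T true e; rewrite /l /u /r; lra. Qed.

Lemma edge_labelE e : edge_label T e = 2 * u e - l e * r e.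
Proof.
case: e => [|b e] /=; first by [].
by have /= := markov_rule T b e; rewrite /l /u /r /=; lra.
Qed.

Lemma directed_awayE e : directed_away T e = (l e * r e < 2 * u e).
Proof. by rewrite /directed_away edge_labelE subr_gt0. Qed.

(** A turn exchanges one root of a quadratic for the other (Vieta), which preserves [disc]. *)
Lemma disc_edge e : disc (l e) (u e) (r e) = discriminator T.
Proof.
elim: e => [|[] e <-]; first by [].
  by rewrite ahead_right /disc /l /r /=; rewrite -/(u e); ring.
by rewrite ahead_left /disc /l /r /=; rewrite -/(u e); ring.
Qed.

(** The edge label is the difference of the roots of [X^2 - l r X + l^2 + r^2 - D]; its square is
    the discriminant. *)
Lemma edge_label_sqr e : (2 * u e - l e * r e) ^+ 2 =
  (l e ^+ 2 - 4) * (r e ^+ 2 - 4) + 4 * (discriminator T - 4).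
Proof. by rewrite -(disc_edge e) /disc; ring. Qed.

Lemma no_decreasing_progression (a d : R) :
  (forall n, 2 <= a + n%:R * d) -> 0 <= d.
Proof.
move=> ge2; rewrite leNgt; apply/negP => d0.
have := archi_boundP (_ : 0 <= `|a| / - d).
rewrite divr_ge0 ?oppr_ge0 ?(ltW d0)// => /(_ isT).
rewrite ltr_pdivrMr ?oppr_gt0// => lt.
have := ge2 (Num.bound (`|a| / - d)); have := ler_norm a; lra.
Qed.

(** * Labels at least 2 *)

Section AtLeastTwo.
Hypothesis T2 : forall x, 2 <= T x.

(** Turning left forever keeps the region labelled 2 on the left, and the labels ahead form an
    arithmetic progression of difference [u e - r e]. *)
Lemma left2_le e : l e = 2 -> r e <= u e.
Proof.
move=> l2; rewrite -subr_ge0.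
suff H n : [/\ l (ncons n false e) = 2,
    u (ncons n false e) = u e + n%:R * (u e - r e) &
    u (ncons n false e) - r (ncons n false e) = u e - r e].
  apply: (@no_decreasing_progression (u e)) => n.
  by have [_ <- _] := H n; exact: T2.
elim: n => [|n [Hl Hu Hd]]; first by split=> //=; ring.
rewrite [ncons _ _ _]/=; move: (ncons n false e) Hl Hu Hd => f Hl Hu Hd.
rewrite ahead_left Hl -natr1 /r /= -/(u f) -/(r f) -/(r e).
by split=> //; lra.
Qed.

Lemma right2_le e : r e = 2 -> l e <= u e.
Proof.
move=> r2; rewrite -subr_ge0.
suff H n : [/\ r (ncons n true e) = 2,
    u (ncons n true e) = u e + n%:R * (u e - l e) &
    u (ncons n true e) - l (ncons n true e) = u e - l e].
  apply: (@no_decreasing_progression (u e)) => n.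
  by have [_ <- _] := H n; exact: T2.
elim: n => [|n [Hr Hu Hd]]; first by split=> //=; ring.
rewrite [ncons _ _ _]/=; move: (ncons n true e) Hr Hu Hd => f Hr Hu Hd.
rewrite ahead_right Hr -natr1 /l /= -/(u f) -/(l f) -/(l e).
by split=> //; lra.
Qed.

(** The region ahead lies beside both children of [e]; the progressions around it in the two
    directions force [l e = r e]. *)
Lemma ahead2_discriminator e : u e = 2 -> discriminator T = 4.
Proof.
move=> u2; have := @right2_le (false :: e) u2; have := @left2_le (true :: e) u2.
rewrite ahead_left ahead_right u2 /l /r /= -/(l e) -/(r e) => le1 le2.
have lr : l e = r e by lra.
by rewrite -(disc_edge e) /disc u2 lr; ring.
Qed.

(** For a left turn, [2u > lr] and [l >= 2] give [lu > 2r]; right turns are symmetric. *)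
Lemma away_child b e : directed_away T e -> directed_away T (b :: e).
Proof.
have := T2 (left_of e); have := T2 (right_of e); have := T2 (Ahead e).
rewrite !directed_awayE; case: b; rewrite ?ahead_left ?ahead_right /l /r /=;
  rewrite -/(u e) -/(l e) -/(r e) => u2 r2 l2; nra.
Qed.

Lemma away_cat f e : directed_away T e -> directed_away T (f ++ e).
Proof. by move=> He; elim: f => [|b f IH] //=; exact: away_child. Qed.

End AtLeastTwo.

(** * Labels above 2: the path of back edges *)

Section AboveTwo.
Hypothesis T2 : forall x, 2 < T x.

Let T2' x : 2 <= T x := ltW (T2 x).

Lemma away_sibling b e : ~~ directed_away T (b :: e) ->
  directed_away T (~~ b :: e).
Proof.
have := T2 (left_of e); have := T2 (right_of e); have := T2 (Ahead e).
rewrite !directed_awayE -!leNgt; case: b => /=;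
  rewrite ?ahead_left ?ahead_right /l /r /=;
  rewrite -/(u e) -/(l e) -/(r e) => u2 r2 l2; nra.
Qed.

(** Here [n] bounds the number of steps, each costing [c]. The drop is assumed only below the
    starting sum, because the constant of [descent_step] depends on such a bound. *)
Lemma nonaway_path (c : R) n e : 0 < c ->
  (forall b f, ~~ directed_away T (b :: f) -> ~~ directed_away T f ->
     l f + r f <= l e + r e ->
     l (b :: f) + r (b :: f) + c <= l f + r f) ->
  l e + r e < n%:R * c -> ~~ directed_away T e ->
  exists p, [/\ path child e p, all (fun f => ~~ directed_away T f) p &
    forall f, ~~ directed_away T (f ++ e) -> f ++ e \in e :: p].
Proof.
move=> c0; elim: n e => [|n IH] e drop lt nae.
  by have := T2 (left_of e); have := T2 (right_of e); rewrite /l /r in lt; lra.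
case: (pickP (fun b => ~~ directed_away T (b :: e))) => [b nab|away].
  have step := drop b e nab nae (lexx _).
  have [||//|p [pathp allp memp]] := IH (b :: e).
  - by move=> b' f ? ? ?; apply: drop => //; lra.
  - by rewrite -natr1 in lt; lra.
  exists ((b :: e) :: p); split=> /=.
  - by rewrite pathp andbT /child; case: (b); rewrite eqxx ?orbT.
  - by rewrite nab.
  (* The last entry of the list is the first turn after [e]; if it differs from [b], it leads to
     edges directed away only. *)
  elim/last_ind=> [|f b' _]; first by rewrite mem_head.
  rewrite cat_rcons => naf; rewrite inE; apply/orP; right.
  suff b'b : b' = b by rewrite b'b in naf *; exact: memp.
  apply/eqP/negPn/negP => b'b; move: naf.
  rewrite away_cat //; have -> : b' = ~~ b by case: (b) (b') b'b => [] [].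
  exact: away_sibling.
exists [::]; split=> //; elim/last_ind=> [|f b _]; first by rewrite mem_head.
by rewrite cat_rcons away_cat //; exact: negbFE (away b).
Qed.

Lemma discriminator_neq4_rising : discriminator T <> 4 -> rising T.
Proof.
move=> D4; split=> //; have [away0|na0] := boolP (directed_away T [::]).
  by exists [::]; split=> // e; rewrite -[e]cats0 away_cat.
have [c c0 step] := descent_step (l [::] + r [::]) D4.
have [||//|p [pathp allp memp]] :=
    @nonaway_path c (Num.bound ((l [::] + r [::]) / c)) [::] c0.
- move=> b f; rewrite !directed_awayE -!leNgt.
  have := T2 (left_of f); have := T2 (right_of f); have := T2 (Ahead f).
  have := disc_edge f.
  case: b; rewrite ?ahead_left ?ahead_right /l /r /=;
    rewrite -/(u f) -/(l f) -/(r f) => df u2 r2 l2 nab na le0.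
    suff : u f + c <= l f by lra.
    (* A right turn replaces [l] by [u], so [descent_step] is used with [l] and [r] exchanged. *)
    apply: (step (r f)) => //; [by rewrite addrC| |lra|lra].
    by rewrite -df /disc; ring.
  suff : u f + c <= r f by lra.
  by apply: (step (l f)) => //; lra.
- rewrite -ltr_pdivrMr //; apply: archi_boundP; apply: divr_ge0 (ltW c0).
  by have := T2 RootLeft; have := T2 RootRight; rewrite /l /r /=; lra.
exists ([::] :: p); split=> [|e]; first by rewrite /= pathp.
have naE : ~~ directed_away T e = (e \in [::] :: p).
  apply/idP/idP => [|ep]; first by have := memp e; rewrite cats0.
  have /allP : all (fun f => ~~ directed_away T f) ([::] :: p) by rewrite /= na0.
  exact.
by rewrite -naE negbK.
Qed.

Lemma disc4_nonaway_child e : discriminator T = 4 -> ~~ directed_away T e ->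
  exists b, ~~ directed_away T (b :: e).
Proof.
rewrite !directed_awayE => D4 na.
have [|l1] := boolP (directed_away T (false :: e)); last by exists false.
have [|l2] := boolP (directed_away T (true :: e)); last by exists true.
rewrite !directed_awayE ahead_left ahead_right /l /r /= in na *.
rewrite -/(u e) -/(l e) -/(r e) in na *; move: na; rewrite -leNgt => na a1 a2.
have := T2 (left_of e); have := T2 (right_of e); have := T2 (Ahead e).
rewrite -/(u e) -/(l e) -/(r e) => u2 r2 l2.
have prod : (2 * u e - l e * r e) * (2 * r e - l e * u e) *
    (2 * l e - u e * r e) =
    (l e ^+ 2 - 4) * (u e ^+ 2 - 4) * (r e ^+ 2 - 4) +
    2 * (disc (l e) (u e) (r e) - 4) * (l e * u e * r e - 8).
  by rewrite /disc; ring.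
rewrite disc_edge D4 subrr mulr0 mul0r addr0 in prod.
have : 0 < (l e ^+ 2 - 4) * (u e ^+ 2 - 4) * (r e ^+ 2 - 4).
  by rewrite !mulr_gt0 //; nra.
rewrite -prod => pos.
(* Both children being directed away makes these factors negative, while [2u - lr <= 0]: the triple
   product cannot be positive. *)
have : 0 <= (2 * r e - l e * u e) * (2 * l e - u e * r e).
  by apply: mulr_le0; lra.
nra.
Qed.

End AboveTwo.

Lemma rising_disc4_away : rising T -> discriminator T = 4 ->
  directed_away T [::].
Proof.
move=> [T2 [p [_ pE]]] D4; apply/negPn/negP => na0.
have memp e : ~~ directed_away T e -> e \in p.
  by move=> nae; apply/negPn/negP => /pE ae; rewrite ae in nae.
have long n : exists e, ~~ directed_away T e /\ size e = n.
  elim: n => [|n [e [nae <-]]]; first by exists [::].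
  by have [b nab] := disc4_nonaway_child T2 D4 nae; exists (b :: e).
(* A back edge deeper than every edge of the finite list [p] cannot belong to it. *)
have [e [/memp ep]] := long (\max_(e <- p) size e).+1.
by apply/eqP; rewrite ltn_eqF // ltnS (@leq_bigmax_seq _ _ xpredT (size : edge -> nat)).
Qed.

Lemma constant_eq2 : (forall x, 2 <= T x) -> constant_tree T ->
  forall x, T x = 2.
Proof.
move=> T2 cst x; have := markov_rule T false [::]; have := T2 x.
rewrite !(cst _ x) => x2 eq; nra.
Qed.

Lemma base222_constant : s0 T = 2 -> u0 T = 2 -> t0 T = 2 -> constant_tree T.
Proof.
move=> s2 u2 t2.
have H e : [/\ l e = 2, u e = 2 & r e = 2].
  elim: e => [|[] e [l2 u2' r2]]; first by split.
    by rewrite ahead_right l2 u2' r2; split=> //; ring.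
  by rewrite ahead_left l2 u2' r2; split=> //; ring.
have T2 x : T x = 2.
  by case: x => [||e] //; have [] := H e.
by move=> x y; rewrite !T2.
Qed.

(** * Classification by the base triple *)

Section Forms.
Hypothesis T2 : forall x, 2 <= T x.

(** [left2_le] at the root gives [t0 <= u0]: strict inequality is progressing, equality is leveling
    or, if [t0 = 2], constant. *)
Lemma left2_form : s0 T = 2 ->
  [\/ progressing T, leveling T | constant_tree T].
Proof.
move=> s2; have := left2_le T2 (e := [::]) s2; rewrite le_eqVlt.
have t2 : 2 <= t0 T := T2 _.
case/orP=> [/eqP tu|tu]; last first.
  apply: Or31; split; rewrite ?s2 ?subrr ?mul0r ?lexx ?t2 //=.
  exact: le_lt_trans t2 tu.
have ut : u0 T = t0 T by [].
move: t2; rewrite le_eqVlt => /orP[/eqP t2|t2].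
  by apply: Or33; apply: base222_constant; rewrite // ut.
apply: Or32; split; last by apply: Or32.
by rewrite /discriminator s2 ut; ring.
Qed.

Lemma right2_form : t0 T = 2 ->
  [\/ progressing T, leveling T | constant_tree T].
Proof.
move=> t2; have := right2_le T2 (e := [::]) t2; rewrite le_eqVlt.
have s2 : 2 <= s0 T := T2 _.
case/orP=> [/eqP su|su]; last first.
  apply: Or31; split; rewrite ?t2 ?subrr ?mulr0 ?lexx ?s2 //=.
  exact: le_lt_trans s2 su.
have us : u0 T = s0 T by [].
move: s2; rewrite le_eqVlt => /orP[/eqP s2|s2].
  by apply: Or33; apply: base222_constant; rewrite // us.
apply: Or32; split; last by apply: Or33.
by rewrite /discriminator t2 us; ring.
Qed.

Lemma away_above2 : 2 < s0 T -> 2 < t0 T -> directed_away T [::] ->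
  forall x, 2 < T x.
Proof.
move=> s2 t2 a0.
have u_gt e : 2 < l e -> 2 < r e -> 2 < u e.
  have : directed_away T e by rewrite -[e]cats0 away_cat.
  by rewrite directed_awayE; nra.
have H e : 2 < l e /\ 2 < r e.
  by elim: e => [|[] e [l2 r2]] //; split=> //; exact: u_gt.
by case=> [||e] //; have [l2 r2] := H e; exact: u_gt.
Qed.

Lemma markov_tree_form :
  [\/ rising T, progressing T, leveling T | constant_tree T].
Proof.
have [s2|s2] := eqVneq (s0 T) 2.
  by case: (left2_form s2); [apply: Or42 | apply: Or43 | apply: Or44].
have [t2|t2] := eqVneq (t0 T) 2.
  by case: (right2_form t2); [apply: Or42 | apply: Or43 | apply: Or44].
have {}s2 : 2 < s0 T by rewrite lt_neqAle eq_sym s2 T2.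
have {}t2 : 2 < t0 T by rewrite lt_neqAle eq_sym t2 T2.
have [D4|/eqP D4] := eqVneq (discriminator T) 4; last first.
  apply: Or41; apply: discriminator_neq4_rising => // -[||e] //.
  rewrite lt_neqAle T2 andbT; apply/eqP => u2.
  by apply: D4; apply: (@ahead2_discriminator T2 e).
have [a0|na0] := boolP (directed_away T [::]).
  apply: Or41; split; first exact: away_above2.
  by exists [::]; split=> // e; rewrite -[e]cats0 away_cat.
apply: Or43; split=> //; apply: Or31; split=> //.
rewrite (T2 _) /= ltr_pdivlMr //.
(* For [D = 4] the squared root label is [(s0^2 - 4)(t0^2 - 4) > 0], which makes [u0 < s0 * t0 / 2]
   strict. *)
have := edge_label_sqr [::]; rewrite D4 subrr mulr0 addr0.
move: na0; rewrite directed_awayE /l /u /r /= -/(s0 T) -/(u0 T) -/(t0 T).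
move=> le sq; have : 0 < (s0 T ^+ 2 - 4) * (t0 T ^+ 2 - 4).
  by apply: mulr_gt0; nra.
by rewrite -sq; nra.
Qed.

End Forms.

End Tree.

Theorem theorem11p2 (R : realType) :
  (forall T : markov_tree R, (forall x : region, 2 <= T x) ->
    [\/ rising T, progressing T, leveling T | constant_tree T] /\
    [/\ ~ (rising T /\ progressing T),
        ~ (rising T /\ leveling T) &
        ~ (rising T /\ constant_tree T)] /\
    [/\ ~ (progressing T /\ leveling T),
        ~ (progressing T /\ constant_tree T) &
        ~ (leveling T /\ constant_tree T)]) /\
  (forall T : markov_tree R, (forall x : region, 2 < T x) ->
    discriminator T <> 4 -> rising T).
Proof.
split=> [T T2|T]; last exact: discriminator_neq4_rising.
split; first exact: markov_tree_form.
have cst2 := constant_eq2 T2.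
have gt2_neq x : 2 < T x -> ~ constant_tree T.
  by move=> gt2 /cst2 eq2; rewrite eq2 ltxx in gt2.
have base_prog : progressing T -> 2 < s0 T -> 2 < t0 T -> False.
  move=> [_ _ /eqP]; rewrite mulf_eq0 !subr_eq0.
  by case/orP=> /eqP ->; rewrite ltxx.
split; split.
- by move=> [[gt2 _] prog]; exact: base_prog prog (gt2 _) (gt2 _).
- move=> [ris [D4 lev]]; have [gt2 _] := ris.
  case: lev => [[_ _ /andP[_ ult]]|[s2 _ _]|[t2 _ _]].
  (* Here [u0 < s0 * t0 / 2] says that the root edge is a back edge. *)
  + have := rising_disc4_away ris D4; rewrite directed_awayE /=.
    rewrite -/(s0 T) -/(u0 T) -/(t0 T); lra.
  + by have := gt2 RootLeft; rewrite -/(s0 T) s2 ltxx.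
  + by have := gt2 RootRight; rewrite -/(t0 T) t2 ltxx.
- by move=> [[gt2 _]]; exact: gt2_neq (gt2 RootLeft).
- move=> [prog [_ [[s2 t2 _]|[_ ut _]|[_ us _]]]].
  + exact: base_prog prog s2 t2.
  + by case: prog => _; rewrite ut ltxx andbF.
  + by case: prog; rewrite us ltxx andbF.
- by move=> [[/andP[_ su] _ _] /cst2 eq2]; move: su; rewrite /s0 /u0 !eq2 ltxx.
- move=> [[_ lev] cst].
  by case: lev => [[gt2 _ _]|[_ _ gt2]|[_ _ gt2]]; exact: gt2_neq gt2 cst.
Qed.
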